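(* Let $M$ be a finitely generated locally left Gaussian monoid. Then $M$ is of type $FL$, i.e. $\mathbb{Z}$ (with trivial $M$-action) admits a finite free resolution over $\mathbb{Z}M$.
   Context: Let $M$ be a monoid. For $x,y\in M$, $x$ is a left divisor of $y$ if $y=xz$ for some $z\in M$, and a proper left divisor if moreover one can take $z\neq 1$ (written $x\sqsubset y$). If $z=ux$ for some $u\in M$, then $x$ is a right divisor of $z$ and $z$ is a left multiple of $x$. $M$ is left Noetherian if there is no infinite sequence $x_1\sqsupset x_2\sqsupset\cdots$. A left lcm of $x,y$ is a common left multiple $z$ of $x$ and $y$ such that every common left multiple of $x$ and $y$ is a left multiple of $z$. $M$ is locally left Gaussian if it is right cancellative ($xz=yz$ implies $x=y$), left Noetherian, and any two elements admitting a common left multiple admit a left lcm. $\mathbb{Z}$ is the trivial left $\mathbb{Z}M$-module ($x\cdot 1=1$ for $x\in M$). A finite free resolution of $\mathbb{Z}$ over $\mathbb{Z}M$ is an exact sequence $0\to F_k\to\cdots\to F_0\to\mathbb{Z}\to 0$ of left $\mathbb{Z}M$-modules with each $F_i$ free of finite rank. *)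

(* Defs.v *)
From HB Require Import structures.
From mathcomp Require Import all_boot all_order all_algebra.
From mathcomp Require Import finmap.
From mathcomp Require Import monalg.

Set Implicit Arguments.
Unset Strict Implicit.
Unset Printing Implicit Defensive.

Import GRing.Theory.

Section Divisibility.
Context {M : monoidType}.
Local Open Scope group_scope.
Implicit Types x y z u : M.

Definition proper_left_divisor x y : Prop := exists2 z, z != 1 & y = x * z.

Definition left_multiple z x : Prop := exists u, z = u * x.

Definition common_left_multiple x y z : Prop :=
  left_multiple z x /\ left_multiple z y.

Definition left_lcm x y z : Prop :=
  common_left_multiple x y z /\
  forall z', common_left_multiple x y z' -> left_multiple z' z.

End Divisibility.

Definition right_cancellative (M : monoidType) : Prop :=
  forall x y z : M, (x * z = y * z)%g -> x = y.

Definition left_noetherian (M : monoidType) : Prop :=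
  ~ exists x : nat -> M, forall n, proper_left_divisor (x n.+1) (x n).

Definition locally_left_gaussian (M : monoidType) : Prop :=
  [/\ right_cancellative M,
      left_noetherian M
    & forall x y : M, (exists z, common_left_multiple x y z) ->
        exists z, left_lcm x y z].

Definition finitely_generated (M : monoidType) : Prop :=
  exists s : seq M, forall x : M,
    exists2 w : seq M, {subset w <= s} & x = (\prod_(y <- w) y)%g.

(* The ring structure that monalg puts on {malg int[K]} requires that K have no
   unit other than 1, hence an alias of the additive group, which carries
   the convolution product for an arbitrary monoid. *)
Definition monoid_ring (M : monoidType) : Type := {malg int[M]}.

Section MonoidRing.
Context {M : monoidType}.
Local Open Scope fset_scope.
Local Open Scope ring_scope.
Local Notation ZM := (monoid_ring M).

HB.instance Definition _ := GRing.Zmodule.copy (monoid_ring M) {malg int[M]}.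

Definition mr_one : ZM := << 1%g >>.

Definition mr_mul (a b : ZM) : ZM :=
  \sum_(x <- msupp a) \sum_(y <- msupp b) << a@_x * b@_y *g (x * y)%g >>.

Lemma mr_mulw (d e : {fset M}) (a b : ZM) :
  msupp a `<=` d -> msupp b `<=` e ->
  mr_mul a b = \sum_(x <- d) \sum_(y <- e) << a@_x * b@_y *g (x * y)%g >>.
Proof.
move=> ad be; rewrite /mr_mul (big_fset_incl _ ad) /= => [|x _ xNa].
  apply: eq_bigr => x _; apply: big_fset_incl => // y _ yNb.
  by rewrite (mcoeff_outdom yNb) mulr0 monalgU0.
by rewrite big1 // => y _; rewrite (mcoeff_outdom xNa) mul0r monalgU0.
Qed.

Lemma mr_mulDl : left_distributive mr_mul +%R.
Proof.
move=> a b c.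
rewrite (mr_mulw (msuppD_le a b) (fsubset_refl (msupp c))).
rewrite (mr_mulw (fsubsetUl (msupp a) (msupp b)) (fsubset_refl (msupp c))).
rewrite (mr_mulw (fsubsetUr (msupp a) (msupp b)) (fsubset_refl (msupp c))).
rewrite -big_split; apply: eq_bigr => x _; rewrite -big_split.
by apply: eq_bigr => y _; rewrite mcoeffD mulrDl monalgUD.
Qed.

Lemma mr_mulDr : right_distributive mr_mul +%R.
Proof.
move=> c a b.
rewrite (mr_mulw (fsubset_refl (msupp c)) (msuppD_le a b)).
rewrite (mr_mulw (fsubset_refl (msupp c)) (fsubsetUl (msupp a) (msupp b))).
rewrite (mr_mulw (fsubset_refl (msupp c)) (fsubsetUr (msupp a) (msupp b))).
rewrite -big_split; apply: eq_bigr => x _; rewrite -big_split.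
by apply: eq_bigr => y _; rewrite mcoeffD mulrDr monalgUD.
Qed.

Lemma mr_mul0 a : mr_mul 0 a = 0.
Proof. by rewrite /mr_mul msupp0 big_seq_fset0. Qed.

Lemma mr_mul_0 a : mr_mul a 0 = 0.
Proof.
by rewrite /mr_mul big1 // => x _; rewrite msupp0 big_seq_fset0.
Qed.

Lemma mr_mulUU (m n : int) (x y : M) :
  mr_mul << m *g x >> << n *g y >> = << m * n *g (x * y)%g >>.
Proof. by rewrite (mr_mulw msuppU_le msuppU_le) !big_seq_fset1 !mcoeffUU. Qed.

Lemma mr_mul_suml I (r : seq I) (F : I -> ZM) b :
  mr_mul (\sum_(i <- r) F i) b = \sum_(i <- r) mr_mul (F i) b.
Proof.
by apply: (big_morph (mr_mul^~ b)) => [a c|]; rewrite ?mr_mulDl ?mr_mul0.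
Qed.

Lemma mr_mul_sumr I (r : seq I) (F : I -> ZM) a :
  mr_mul a (\sum_(i <- r) F i) = \sum_(i <- r) mr_mul a (F i).
Proof.
by apply: (big_morph (mr_mul a)) => [b c|]; rewrite ?mr_mulDr ?mr_mul_0.
Qed.

Lemma mr_mulEl (a b : ZM) :
  mr_mul a b = \sum_(x <- msupp a) mr_mul << a@_x *g x >> b.
Proof. by rewrite [in LHS](monalgE a) mr_mul_suml. Qed.

Lemma mr_mulEr (a b : ZM) :
  mr_mul a b = \sum_(x <- msupp b) mr_mul a << b@_x *g x >>.
Proof. by rewrite [in LHS](monalgE b) mr_mul_sumr. Qed.

Lemma mr_mulA : associative mr_mul.
Proof.
move=> a b c; rewrite mr_mulEl [RHS]mr_mul_suml.
apply: eq_bigr => x _; rewrite [LHS]mr_mul_sumr [RHS]mr_mul_suml.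
apply: eq_bigr => y _; rewrite [LHS]mr_mul_sumr [RHS]mr_mulEr.
by apply: eq_bigr => z _; rewrite !mr_mulUU mulrA mulgA.
Qed.

Lemma mr_mul1 : left_id mr_one mr_mul.
Proof.
move=> a; rewrite mr_mulEr [RHS]monalgE.
by apply: eq_bigr => x _; rewrite mr_mulUU mul1r mul1g.
Qed.

Lemma mr_mul_1 : right_id mr_one mr_mul.
Proof.
move=> a; rewrite mr_mulEl [RHS]monalgE.
by apply: eq_bigr => x _; rewrite mr_mulUU mulr1 mulg1.
Qed.

Lemma mr_one_neq0 : mr_one != 0.
Proof. by rewrite monalgU_eq0. Qed.

HB.instance Definition _ := GRing.Zmodule_isNzRing.Build (monoid_ring M)
  mr_mulA mr_mul1 mr_mul_1 mr_mulDl mr_mulDr mr_one_neq0.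

Definition mr_of (x : M) : ZM := << x >>.

Lemma mr_of1 : mr_of 1%g = 1.
Proof. by []. Qed.

Lemma mr_ofM (x y : M) : mr_of (x * y)%g = mr_of x * mr_of y.
Proof. by rewrite [RHS]mr_mulUU mulr1. Qed.

Definition augmentation (a : ZM) : int := \sum_(x <- msupp a) a@_x.

Lemma augmentationw (d : {fset M}) (a : ZM) :
  msupp a `<=` d -> augmentation a = \sum_(x <- d) a@_x.
Proof. by move=> ad; apply: big_fset_incl => // x _ /mcoeff_outdom. Qed.

Lemma augmentationD : {morph augmentation : a b / a + b}.
Proof.
move=> a b; rewrite (augmentationw (msuppD_le a b)).
rewrite (augmentationw (fsubsetUl (msupp a) (msupp b))).
rewrite (augmentationw (fsubsetUr (msupp a) (msupp b))).
by rewrite -big_split; apply: eq_bigr => x _; rewrite mcoeffD.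
Qed.

Lemma augmentation0 : augmentation 0 = 0.
Proof. by rewrite /augmentation msupp0 big_seq_fset0. Qed.

Lemma augmentationU (n : int) (x : M) : augmentation << n *g x >> = n.
Proof. by rewrite (augmentationw msuppU_le) big_seq_fset1 mcoeffUU. Qed.

Lemma augmentation_sum I (r : seq I) (F : I -> ZM) :
  augmentation (\sum_(i <- r) F i) = \sum_(i <- r) augmentation (F i).
Proof. exact: (big_morph _ augmentationD augmentation0). Qed.

Lemma augmentationM : {morph augmentation : a b / a * b}.
Proof.
move=> a b; rewrite augmentation_sum [RHS]mulr_suml.
apply: eq_bigr => x _; rewrite augmentation_sum mulr_sumr.
by apply: eq_bigr => y _; rewrite augmentationU.
Qed.

End MonoidRing.

(* The group of integers as a left ZM-module on which M acts trivially. *)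
Definition trivial_module (M : monoidType) : Type := int.

Section TrivialModule.
Context {M : monoidType}.
Local Open Scope ring_scope.

HB.instance Definition _ := GRing.Zmodule.copy (trivial_module M) int.

Definition trivial_scale (a : monoid_ring M) (n : trivial_module M) :
  trivial_module M := augmentation a * n.

Lemma trivial_scaleA a b n :
  trivial_scale a (trivial_scale b n) = trivial_scale (a * b) n.
Proof. by rewrite /trivial_scale augmentationM mulrA. Qed.

Lemma trivial_scale1 : left_id 1 trivial_scale.
Proof. by move=> n; rewrite /trivial_scale augmentationU mul1r. Qed.

Lemma trivial_scaleDr : right_distributive trivial_scale +%R.
Proof. by move=> a m n; rewrite /trivial_scale mulrDr. Qed.

Lemma trivial_scaleDl n : {morph trivial_scale^~ n : a b / a + b}.
Proof. by move=> a b; rewrite /trivial_scale augmentationD mulrDl. Qed.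

HB.instance Definition _ :=
  GRing.Zmodule_isLmodule.Build (monoid_ring M) (trivial_module M)
    trivial_scaleA trivial_scale1 trivial_scaleDr trivial_scaleDl.

Lemma mr_of_trivial (x : M) (n : trivial_module M) : mr_of x *: n = n.
Proof. by rewrite /GRing.scale /= /trivial_scale augmentationU mul1r. Qed.

End TrivialModule.

Section Resolutions.
Context {R : nzRingType}.
Local Open Scope ring_scope.

Definition free_of_finite_rank (V : lmodType R) : Prop :=
  exists n (e : 'I_n -> V),
    forall v, exists! c : {ffun 'I_n -> R}, v = \sum_i c i *: e i.

Definition exact_at (U V W : lmodType R) (f : U -> V) (g : V -> W) : Prop :=
  forall v, g v = 0 <-> exists u, f u = v.

(* The sequence 0 -> F k -> ... -> F 0 -> A -> 0 is encoded by a family indexed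
   by nat that vanishes above k; exactness at F k then expresses the
   injectivity of the leftmost map. *)
Definition finite_free_resolution (A : lmodType R) (k : nat)
    (F : nat -> lmodType R) (d : forall i, {linear F i.+1 -> F i})
    (eps : {linear F 0%N -> A}) : Prop :=
  [/\ forall i, (i <= k)%N -> free_of_finite_rank (F i),
      forall i, (k < i)%N -> forall v : F i, v = 0,
      forall a, exists v, eps v = a,
      exact_at (d 0%N) eps
    & forall i, exact_at (d i.+1) (d i)].

Definition has_finite_free_resolution (A : lmodType R) : Prop :=
  exists k F d eps, @finite_free_resolution A k F d eps.

End Resolutions.

Definition type_FL (M : monoidType) : Prop :=
  has_finite_free_resolution (R := monoid_ring M) (trivial_module M).

(* Main.v *)
(* Dehornoy and Lafont's order resolution. Number the generators X_0, ..., X_(m-1)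
   (all different from 1). An n-cell is a sequence i_1 < ... < i_n such that the
   left lcm of X_(i_k), ..., X_(i_n) exists and has X_(i_k) as its least right
   divisor among the generators, for each k; in particular n <= m. The free module
   on n-cells has the Z-basis x[c]; its elements are ordered by the norm
   x * lcm(c) (for proper left divisibility, which is well-founded), then by the
   first generator of c. Call x[c] reducible if some generator smaller than the
   first one of c right-divides its norm. By right cancellation, y[i, c] |->
   x[c] (same norm) is a bijection from irreducible elements of degree n+1 to
   reducible elements of degree n. The boundary of [i, c] is its image under this
   bijection minus lower terms, chosen so as to have boundary 0. Reducing modulo
   boundaries, by well-founded induction, leaves an irreducible chain, and the
   boundary is injective on irreducible chains because leading terms do not
   cancel; exactness follows. *)
Require Import Defs.
From HB Require Import structures.
From mathcomp Require Import all_boot all_order all_algebra.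
From mathcomp Require Import finmap.
From mathcomp Require Import monalg.
From mathcomp Require Import boolp.

Set Implicit Arguments.
Unset Strict Implicit.
Unset Printing Implicit Defensive.

Import GRing.Theory.

(** * Well-foundedness and maximal elements *)

Lemma no_infinite_descent_wf T (r : T -> T -> Prop) :
  ~ (exists x : nat -> T, forall n, r (x n.+1) (x n)) -> well_founded r.
Proof.
move=> ndesc x0; apply: contrapT => x0P; apply: ndesc.
have step (x : {x | ~ Acc r x}) :
    exists y : {x | ~ Acc r x}, r (sval y) (sval x).
  case: x => x xP /=; apply: contrapT => nex; apply: xP; constructor => y ryx.
  by apply: contrapT => yP; apply: nex; exists (exist _ y yP).
have [f fP] := choice step.
by exists (fun n => sval (iter n f (exist _ x0 x0P))) => n; apply: fP.
Qed.

Lemma exists_maximal (T : eqType) (r : T -> T -> Prop) (x0 : T) (s : seq T) :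
    (forall x, ~ r x x) -> (forall x y z, r x y -> r y z -> r x z) ->
  x0 \in s -> exists2 x, x \in s & forall y, y \in s -> ~ r x y.
Proof.
move=> rxx rtr; elim: s x0 => // a [|b s] IHs x0 _.
  by exists a; rewrite ?mem_head // => y; rewrite inE => /eqP->.
have [x xs xmax] := IHs b (mem_head _ _).
have [rxa|nrxa] := pselect (r x a).
  exists a; rewrite ?mem_head // => y; rewrite inE => /predU1P[->//|ys ray].
  exact: xmax ys (rtr _ _ _ rxa ray).
exists x; first by rewrite inE xs orbT.
by move=> y; rewrite inE => /predU1P[->//|ys]; apply: xmax.
Qed.

(** * Free modules and their Z-bases *)

Section FreeModules.
Context {M : monoidType} {K : finType}.
Local Open Scope ring_scope.
Local Notation ZM := (monoid_ring M).
Local Notation F := {ffun K -> ZM^o}.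

Definition coef (b : M * K) (v : F) : int :=
  mcoeff b.1 (v b.2 : {malg int[M]}).

Fact coef_is_additive b : zmod_morphism (coef b).
Proof. by move=> u v; rewrite /coef !ffunE; apply: mcoeffB. Qed.

HB.instance Definition _ b :=
  GRing.isZmodMorphism.Build F int (coef b) (coef_is_additive b).

Lemma coef0 b : coef b 0 = 0.
Proof. exact: raddf0. Qed.

Lemma coefB b u v : coef b (u - v) = coef b u - coef b v.
Proof. exact: raddfB. Qed.

Definition bas (b : M * K) : F := [ffun c => if c == b.2 then mr_of b.1 else 0].

Definition lies (P : M * K -> Prop) (v : F) : Prop :=
  forall b, coef b v != 0 -> P b.

Lemma coef_bas b c : coef c (bas b) = (b == c)%:R.
Proof.
case: b c => x a [y c]; rewrite /coef ffunE /= xpair_eqE eq_sym.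
case: eqP => _; last by rewrite andbF mcoeff0.
by rewrite andbT mcoeffU.
Qed.

Lemma scale_bas x b : mr_of x *: bas b = bas ((x * b.1)%g, b.2).
Proof.
apply/ffunP => c; rewrite !ffunE /=; case: ifP => _; last exact: mulr0.
by rewrite mr_ofM.
Qed.

Lemma coef_eqP (u v : F) : (forall b, coef b u = coef b v) -> u = v.
Proof.
move=> uv; apply/ffunP => c; apply/malgP => x; exact: uv (x, c).
Qed.

Definition supp (v : F) : seq (M * K) :=
  [seq (x, c) | c <- enum K, x <- msupp (v c : {malg int[M]})].

Lemma mem_supp b (v : F) : (b \in supp v) = (coef b v != 0).
Proof.
rewrite /coef mcoeff_neq0; apply/allpairsPdep/idP => [[c [x [_ xv ->]]]//|xv].
by exists b.2, b.1; split; rewrite ?mem_enum -?surjective_pairing.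
Qed.

Lemma bas_expand (v : F) : v = \sum_(b <- supp v) bas b *~ coef b v.
Proof.
apply: coef_eqP => b; rewrite raddf_sum /=.
under eq_bigr do rewrite raddfMz /= coef_bas.
have [bv|] := boolP (b \in supp v); last first.
  move=> bv; move: (bv); rewrite mem_supp negbK => /eqP->.
  rewrite big1_seq // => c /andP[_ cv].
  by case: eqP => [cb|_]; [rewrite -cb cv in bv | rewrite mul0rz].
rewrite (bigD1_seq b) //=.
  rewrite eqxx big1 ?addr0; first by rewrite mulrzz mul1r.
  by move=> c /negPf->; rewrite mul0rz.
apply: allpairs_uniq_dep => [|c _|[? ?] [? ?] _ _ [-> ->]//].
  exact: enum_uniq.
exact: fset_uniq.
Qed.

Lemma lies_ind (P : M * K -> Prop) (Q : F -> Prop) (v : F) :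
    Q 0 -> (forall u w, Q u -> Q w -> Q (u - w)) ->
    (forall b, P b -> Q (bas b)) ->
  lies P v -> Q v.
Proof.
move=> Q0 QB Qb vP.
have QN w : Q w -> Q (- w) by rewrite -sub0r; apply: QB.
have QD u w : Q u -> Q w -> Q (u + w).
  by move=> Qu Qw; rewrite -[w]opprK; apply/QB/QN.
have QMn w n : Q w -> Q (w *+ n).
  by move=> Qw; elim: n => // n IHn; rewrite mulrS; apply: QD.
rewrite (bas_expand v) big_seq; apply: (big_ind Q) => // b.
rewrite mem_supp => /vP /Qb Qbas.
by case: (coef b v) => n; [apply: QMn | apply/QN/QMn].
Qed.

Lemma lies0 P : lies P 0.
Proof. by move=> b; rewrite coef0 eqxx. Qed.

Lemma liesB P u v : lies P u -> lies P v -> lies P (u - v).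
Proof.
move=> Pu Pv b; rewrite coefB.
have [->|/Pu//] := eqVneq (coef b u) 0; have [->|/Pv//] := eqVneq (coef b v) 0.
by rewrite subrr eqxx.
Qed.

Lemma liesN P u : lies P u -> lies P (- u).
Proof. by move=> Pu; rewrite -sub0r; exact: liesB (@lies0 P) Pu. Qed.

Lemma liesD P u v : lies P u -> lies P v -> lies P (u + v).
Proof. by move=> Pu Pv; rewrite -[v]opprK; exact: liesB Pu (liesN Pv). Qed.

Lemma lies_bas (P : M * K -> Prop) b : P b -> lies P (bas b).
Proof. by move=> Pb c; rewrite coef_bas; case: (b =P c) => [<-|_] //; rewrite eqxx. Qed.

Lemma lies_sub (P Q : M * K -> Prop) v :
  (forall b, P b -> Q b) -> lies P v -> lies Q v.
Proof. by move=> PQ Pv b /Pv /PQ. Qed.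

Lemma lies_scale (P Q : M * K -> Prop) x v :
  (forall b, P b -> Q ((x * b.1)%g, b.2)) -> lies P v ->
  lies Q (mr_of x *: v).
Proof.
move=> PQ vP.
refine (lies_ind (Q := fun w => lies Q (mr_of x *: w)) _ _ _ vP).
- by rewrite scaler0; exact: lies0.
- by move=> u w Qu Qw; rewrite scalerBr; exact: liesB.
- by move=> b Pb; rewrite scale_bas; exact: lies_bas (PQ _ Pb).
Qed.

Section Extension.
Context {V : lmodType ZM} (g : K -> V).

Definition extend (v : F) : V := \sum_c (v c : ZM) *: g c.

Fact extend_is_linear : linear extend.
Proof.
move=> a u v; rewrite /extend scaler_sumr -big_split /=.
by apply: eq_bigr => c _; rewrite !ffunE scalerDl scalerA.
Qed.

HB.instance Definition _ :=
  GRing.isLinear.Build ZM F V _ extend extend_is_linear.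

Lemma extend_bas b : extend (bas b) = mr_of b.1 *: g b.2.
Proof.
rewrite /extend (bigD1 b.2) //= ffunE eqxx big1 ?addr0 // => c /negPf cb.
by rewrite ffunE cb scale0r.
Qed.

End Extension.

Lemma free_ffun : free_of_finite_rank (F : lmodType ZM).
Proof.
have E (c : {ffun 'I_#|K| -> ZM}) k :
    (\sum_i c i *: bas (1%g, enum_val i)) k = c (enum_rank k).
  have bE i : (c i *: bas (1%g, enum_val i)) k =
      if i == enum_rank k then c i else 0.
    rewrite ffunE ffunE /= -(can_eq enum_valK) enum_rankK eq_sym.
    case: ifP => _; last exact: mulr0.
    exact: mulr1.
  rewrite sum_ffunE (eq_bigr _ (fun i _ => bE i)) -big_mkcond /=.
  by rewrite big_pred1_eq.
exists #|K|, (fun i => bas (1%g, enum_val i)) => v.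
exists [ffun i => v (enum_val i)]; split.
  by apply/ffunP => k; rewrite E ffunE enum_rankK.
by move=> c ->; apply/ffunP => i; rewrite ffunE E enum_valK.
Qed.

End FreeModules.

Section OrderResolution.
Context {M : monoidType} (m : nat) (X : 'I_m -> M) (lcm cof : M -> M -> M).
Hypothesis mulIg : right_cancellative M.
Hypothesis divisor_wf : well_founded (@proper_left_divisor M).
Hypothesis lcmP : forall x y, (exists z, common_left_multiple x y z) ->
  left_lcm x y (lcm x y).
Hypothesis cofP : forall x y, (exists z, common_left_multiple x y z) ->
  lcm x y = (cof x y * y)%g.
Hypothesis X_neq1 : forall i, X i != 1%g.
Hypothesis X_gen : forall x : M, x != 1%g -> exists i, left_multiple x (X i).
Local Notation ZM := (monoid_ring M).
Implicit Types x y z : M.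

(** * Divisibility in a left Noetherian monoid *)

Lemma proper_left_divisor_asym x y :
  proper_left_divisor x y -> ~ proper_left_divisor y x.
Proof.
elim/(well_founded_ind divisor_wf): x y => x IHx y xy yx.
exact: (IHx y yx x yx xy).
Qed.

Lemma proper_left_divisor_irr x : ~ proper_left_divisor x x.
Proof. by move=> xx; exact: (proper_left_divisor_asym xx xx). Qed.

(** If neither factor were 1, [x] and 1 would properly left-divide each other. *)
Lemma mulg_eq1 x y : (x * y)%g = 1%g -> x = 1%g.
Proof.
move=> xy1; have [y1|y1] := eqVneq y 1%g; first by rewrite -xy1 y1 mulg1.
have [//|x1] := eqVneq x 1%g.
case: (@proper_left_divisor_asym x 1%g); first by exists y.
by exists x; rewrite ?mul1g.
Qed.

Lemma proper_left_divisor_trans x y z :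
  proper_left_divisor x y -> proper_left_divisor y z -> proper_left_divisor x z.
Proof.
move=> [u u1 ->] [v v1 ->]; exists (u * v)%g; last by rewrite mulgA.
by apply: contra_neq u1 => /mulg_eq1.
Qed.

Lemma left_multiple_trans x y z :
  left_multiple x y -> left_multiple y z -> left_multiple x z.
Proof. by move=> [u ->] [v ->]; exists (u * v)%g; rewrite mulgA. Qed.

(* A cell [i_1, ..., i_n] of the resolution enters the construction only through
   its norm, the left lcm of its generators, and its first generator i_1. A pair
   (x, c) stands for the Z-basis element x[c] of the free module on the cells. *)
Record cells := Cells { cell :> finType; nrm : cell -> M; first : cell -> nat }.
Implicit Types K : cells.

Local Notation chain K := {ffun cell K -> ZM^o}.

(** * The order on basis elements *)

Definition norm K (b : M * K) : M := (b.1 * nrm b.2)%g.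

Definition reducible K (b : M * K) : Prop :=
  exists2 i : 'I_m, i < first b.2 & left_multiple (norm b) (X i).

Definition below K (b c : M * K) : Prop :=
  proper_left_divisor (norm b) (norm c) \/
  norm b = norm c /\ first b.2 < first c.2.

Lemma below_irr K (b : M * K) : ~ below b b.
Proof. by case=> [/proper_left_divisor_irr|[_]]; rewrite ?ltnn. Qed.

Lemma below_trans K (b c d : M * K) : below b c -> below c d -> below b d.
Proof.
move=> [bc|[bc lbc]] [cd|[cd lcd]].
- by left; apply: proper_left_divisor_trans cd.
- by left; rewrite -cd.
- by left; rewrite bc.
- by right; rewrite bc; split=> //; apply: ltn_trans lcd.
Qed.

Lemma below_mul K x (b c : M * K) :
  below b c -> below ((x * b.1)%g, b.2) ((x * c.1)%g, c.2).
Proof.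
rewrite /below /norm /= -!mulgA => -[[u u1 ->]|[-> ?]]; last by right.
by left; exists u; rewrite ?mulgA.
Qed.

Lemma below_wf K : well_founded (@below K).
Proof.
suff H x n (b : M * K) : norm b = x -> first b.2 < n -> Acc (@below K) b.
  by move=> b; apply: H (erefl _) (ltnSn _).
elim/(well_founded_ind divisor_wf): x n b => x IHx n.
elim: n => [b _|n IHn b bx]; first by rewrite ltn0.
rewrite ltnS => bn; constructor => c.
case=> [cb|[cb lcb]]; first by apply: IHx (erefl _) (ltnSn _); rewrite -bx.
by apply: IHn; [rewrite cb | apply: leq_trans bn].
Qed.

(** Such predicates pass down along [below]; they keep a reduction among the left divisors of one
    norm. *)
Definition left_divisor_closed (P : M -> Prop) : Prop :=
  forall x y, P (x * y)%g -> P x.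

Lemma below_closed K (P : M -> Prop) (b c : M * K) :
  left_divisor_closed P -> below b c -> P (norm c) -> P (norm b).
Proof. by move=> Pcl [[u _ ->]|[-> _]] // /Pcl. Qed.

(** * Cells of the next degree *)

Definition is_next K (p : 'I_m * K) : Prop :=
  [/\ p.1 < first p.2,
      exists z, common_left_multiple (X p.1) (nrm p.2) z
    & forall i : 'I_m, i < p.1 -> ~ left_multiple (lcm (X p.1) (nrm p.2)) (X i)].

(** Deciding [is_next] classically keeps the cells a finite type. *)
Definition next K : cells :=
  @Cells {p : 'I_m * K | `[< is_next p >]}
    (fun p => lcm (X (val p).1) (nrm (val p).2)) (fun p => (val p).1).

(* [lead] is a bijection from the irreducible pairs over [next K] onto the
   reducible pairs over [K] ([lead_reducible], [lead_surj], [lead_inj]); it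
   preserves norms. *)
Definition lead K (b : M * next K) : M * K :=
  ((b.1 * cof (X (val b.2).1) (nrm (val b.2).2))%g, (val b.2).2).

Lemma norm_lead K (b : M * next K) : norm (lead b) = norm b.
Proof.
case: b => x [p pP] /=; have [_ pm _] := asboolP _ pP.
by rewrite /norm /= -mulgA -cofP.
Qed.

Lemma left_multiple_first K (b : M * next K) :
  left_multiple (norm b) (X (val b.2).1).
Proof.
case: b => x [p pP]; have [_ pm _] := asboolP _ pP.
have [[[u lu] _] _] := lcmP pm.
by exists (x * u)%g; rewrite /norm /= lu mulgA.
Qed.

Lemma lead_reducible K (b : M * next K) : reducible (lead b).
Proof.
exists (val b.2).1; last by rewrite norm_lead; apply: left_multiple_first.
by case: b => x [p pP]; have [] := asboolP _ pP.
Qed.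

Lemma irreducible_first K (b : M * K) (i : 'I_m) :
  ~ reducible b -> left_multiple (norm b) (X i) -> first b.2 <= i.
Proof. by move=> bI bi; rewrite leqNgt; apply/negP => ib; apply: bI; exists i. Qed.

(** The index to prepend is the least generator right-dividing the norm of [c]; this norm is then
    [y] times the lcm. *)
Lemma lead_surj K (c : M * K) :
  reducible c -> exists2 b : M * next K, ~ reducible b & lead b = c.
Proof.
case=> j jc cj.
pose P (i : 'I_m) := (i < first c.2) && `[< left_multiple (norm c) (X i) >].
have [|i /andP[ic /asboolP ci] imin] := @arg_minnP _ j P (@nat_of_ord m).
  by rewrite /P jc; apply/asboolP.
have low (k : 'I_m) : k < i -> ~ left_multiple (norm c) (X k).
  move=> ki ck; have /imin : P k; last by rewrite leqNgt ki.
  by rewrite /P (ltn_trans ki ic); apply/asboolP.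
have cc : common_left_multiple (X i) (nrm c.2) (norm c).
  by split=> //; exists c.1.
have pm : exists z, common_left_multiple (X i) (nrm c.2) z by exists (norm c).
have [y yc] := proj2 (lcmP pm) _ cc.
(* Right divisors of the lcm right-divide the norm, so [i] is least for the lcm too. *)
have iP : is_next (i, c.2).
  split=> //= k /low nck ck; apply: nck; apply: left_multiple_trans ck.
  by exists y.
pose b : M * next K := (y, exist _ (i, c.2) (asboolT iP)).
exists b; first by case=> k /low nck bk; apply: nck; rewrite yc.
rewrite [RHS]surjective_pairing /lead /=; congr (_, _).
by apply: (@mulIg _ _ (nrm c.2)); rewrite -mulgA -cofP.
Qed.

(** The first index of an irreducible element is the least generator right-dividing its norm, so the
    common norm determines it. *)
Lemma lead_inj K (b c : M * next K) :
  ~ reducible b -> ~ reducible c -> lead b = lead c -> b = c.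
Proof.
move=> bI cI bc; have nbc : norm b = norm c by rewrite -!norm_lead bc.
have fbc : first b.2 = first c.2.
  apply/eqP; rewrite eqn_leq; apply/andP; split; apply: irreducible_first => //.
    by rewrite nbc; apply: left_multiple_first.
  by rewrite -nbc; apply: left_multiple_first.
have E : b.2 = c.2.
  case: bc => _; move: fbc => /=; case: b.2 c.2 => [[i A] iA] [[j B] jB] /=.
  by move=> /val_inj-ij AB; apply: val_inj; rewrite /= ij AB.
case: b c E nbc {bI cI bc fbc} => [x p] [y q] /= ->.
by rewrite /norm /= => /mulIg->.
Qed.

(* The invariant carried up the resolution: each step only needs to know that
   [e] is injective on irreducible chains and that, modulo ker e, a reducible
   basis element can be lowered. *)
Definition adapted K (V : lmodType ZM) (e : chain K -> V) : Prop :=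
  (forall v, lies (fun b => ~ reducible b) v -> e v = 0%R -> v = 0%R) /\
  (forall b, reducible b ->
     exists u, lies (fun c => below c b) u /\ e u = e (bas b)).

(** * One step of the resolution *)

Section Step.
Local Open Scope ring_scope.
Context (K : cells) (V : lmodType ZM) (e : {linear chain K -> V}).

(** The default 0 makes this total, so boundaries can be defined by recursion before they are known
    to be adapted. *)
Definition lower_part (b : M * K) : chain K :=
  if pselect (exists u, lies (fun c => below c b) u /\ e u = e (bas b))
    is left h then sval (cid h) else 0.

Definition boundary : {linear chain (next K) -> chain K} :=
  extend (fun c : next K => bas (lead (1%g, c)) - lower_part (lead (1%g, c))).

Let boundary0 : boundary 0 = 0. Proof. exact: linear0. Qed.

Let boundaryB u v : boundary (u - v) = boundary u - boundary v.
Proof. exact: linearB. Qed.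

Let boundaryD u v : boundary (u + v) = boundary u + boundary v.
Proof. exact: linearD. Qed.

Hypothesis eP : adapted e.

Lemma lower_partP b : reducible b ->
  lies (fun c => below c b) (lower_part b) /\ e (lower_part b) = e (bas b).
Proof.
move=> /(proj2 eP) bP; rewrite /lower_part; case: pselect => // h.
exact: svalP (cid h).
Qed.

(** Left multiplication preserves [below], so the leading term at 1[c] carries over to x[c]. *)
Lemma boundary_bas (b : M * next K) :
  exists2 u, lies (fun c => below c (lead b)) u &
    boundary (bas b) = bas (lead b) - u.
Proof.
have [uP _] := lower_partP (lead_reducible (1%g, b.2)).
exists (mr_of b.1 *: lower_part (lead (1%g, b.2))).
  apply: lies_scale uP => c /(below_mul b.1).
  by rewrite /lead /= mul1g.
by rewrite [LHS]extend_bas scalerBr scale_bas /lead /= mul1g.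
Qed.

Lemma boundary_complex u : e (boundary u) = 0.
Proof.
rewrite [boundary u]/(extend _ _) /extend linear_sum big1 // => c _.
have [_ E] := lower_partP (lead_reducible (1%g, c)).
by rewrite linearZ linearB /= E subrr scaler0.
Qed.

(** Subtracting the boundary of the irreducible [c] with leading term [b] leaves lower terms, to
    which induction on [below] applies. *)
Lemma reduction (P : M -> Prop) (v : chain K) :
    left_divisor_closed P -> lies (fun b => P (norm b)) v ->
  exists2 t : chain (next K),
    lies (fun b => ~ reducible b /\ P (norm b)) t &
    lies (fun b => ~ reducible b) (v - boundary t).
Proof.
move=> Pcl.
pose Q v := exists2 t : chain (next K),
  lies (fun b => ~ reducible b /\ P (norm b)) t &
  lies (fun b => ~ reducible b) (v - boundary t).
have Q0 : Q 0.
  by exists 0; [exact: lies0 | rewrite boundary0 subr0; exact: lies0].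
have QB u w : Q u -> Q w -> Q (u - w).
  move=> [s sP us] [t tP wt]; exists (s - t); first exact: liesB.
  rewrite boundaryB (_ : _ - _ = (u - boundary s) - (w - boundary t)).
    exact: liesB.
  by rewrite opprD addrACA -opprD.
apply: (@lies_ind _ _ _ Q) => //= b; elim/(well_founded_ind (@below_wf K)): b.
move=> b IHb bP; have [bR|bI] := pselect (reducible b); last first.
  by exists 0; [exact: lies0 | rewrite boundary0 subr0; exact: lies_bas].
have [c cI cb] := lead_surj bR; have [u uP cu] := boundary_bas c.
have [t tP ut] : Q u.
  apply: lies_ind uP => // d; rewrite cb => db; apply: IHb => //.
  exact: below_closed Pcl db bP.
exists (bas c + t).
  apply: (liesD _ tP); apply: lies_bas; split => //.
  by rewrite -norm_lead cb.
rewrite boundaryD cu cb (_ : _ - _ = u - boundary t) //.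
by rewrite opprD addrA subKr.
Qed.

(** The irreducible remainder lies in the kernel of [e], hence vanishes. *)
Lemma boundary_preimage (P : M -> Prop) (v : chain K) :
    left_divisor_closed P -> lies (fun b => P (norm b)) v -> e v = 0 ->
  exists2 t : chain (next K),
    lies (fun b => ~ reducible b /\ P (norm b)) t & boundary t = v.
Proof.
move=> Pcl vP ev0; have [t tP vt] := reduction Pcl vP; exists t => //.
apply/esym/subr0_eq; apply: (proj1 eP) => //.
by rewrite linearB /= ev0 boundary_complex subrr.
Qed.

Lemma boundary_exact_at : exact_at boundary e.
Proof.
move=> v; split=> [ev0|[u <-]]; last exact: boundary_complex.
have [||t _ tv] := @boundary_preimage (fun=> True) v _ _ ev0 => //.
by exists t.
Qed.

(* Leading terms of distinct irreducible elements are distinct, so a maximal one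
   cannot be cancelled by the lower terms of the others. *)
Lemma coef_lead_boundary (v : chain (next K)) b : ~ reducible b ->
    lies (fun c => ~ reducible c /\ ~ below (lead b) (lead c)) v ->
  coef (lead b) (boundary v) = coef b v.
Proof.
move=> bI.
apply: (@lies_ind _ _ _ (fun v => coef (lead b) (boundary v) = coef b v)).
- by rewrite boundary0 !coef0.
- move=> u w Eu Ew; rewrite boundaryB [LHS]coefB [RHS]coefB.
  by rewrite [X in X - _]Eu [X in _ - X]Ew.
move=> c [cI nbc]; have [u uP ->] := boundary_bas c.
rewrite coefB !coef_bas.
have -> : coef (lead b) u = 0 by apply/eqP/negP => /negP /uP.
rewrite subr0; congr (nat_of_bool _)%:R.
by apply/eqP/eqP => [/lead_inj->|->].
Qed.

Lemma boundary_adapted : adapted boundary.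
Proof.
split=> [v vI bv0|b bR].
  apply: coef_eqP => b0; rewrite coef0; apply/eqP/negPn/negP => b0v.
  (* An element of the support with maximal leading term keeps its nonzero coefficient in the
     boundary. *)
  have [|||b bv bmax] := @exists_maximal _
    (fun b c : M * next K => below (lead b) (lead c)) b0 (supp v).
  - by move=> b; apply: below_irr.
  - by move=> b c d; apply: below_trans.
  - by rewrite mem_supp.
  move: (bv); rewrite mem_supp => /[dup] /vI bI /negP; apply.
  rewrite -coef_lead_boundary // ?bv0 ?coef0 // => c cv.
  by split; [apply: vI | apply: bmax; rewrite mem_supp].
(* The cycle [boundary (bas b)] has an irreducible preimage whose norms left-divide that of [b]. *)
pose P x := exists y, norm b = (x * y)%g.
have Pcl : left_divisor_closed P.
  by move=> x y [z bz]; exists (y * z)%g; rewrite bz mulgA.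
have Pb : P (norm b) by exists 1%g; rewrite mulg1.
have bP : lies (fun c => P (norm c)) (boundary (bas b)).
  have [u uP ->] := boundary_bas b; rewrite -norm_lead in Pb.
  apply: liesB; first exact: lies_bas.
  by apply: lies_sub uP => c cb; apply: below_closed cb Pb.
have [t tP tb] := boundary_preimage Pcl bP (boundary_complex _).
exists t; split; last exact: tb.
apply: lies_sub tP => c [cI [y bcy]].
have [y1|y1] := eqVneq y 1%g; last by left; exists y.
have bc : norm c = norm b by rewrite bcy y1 mulg1.
(* At equal norm, a generator [i] making [b] reducible bounds the first index of the irreducible
   [c]. *)
right; split; first exact: bc.
have [i ib bi] := bR; rewrite -bc in bi.
exact: leq_ltn_trans (irreducible_first cI bi) ib.
Qed.

End Step.

(** * The augmentation and the whole resolution *)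

Local Open Scope ring_scope.

(* The empty cell has no first generator: its index is set to m, above all. *)
Definition unit_cells : cells := @Cells unit (fun=> 1%g) (fun=> m).

Definition aug : {linear chain unit_cells -> trivial_module M} :=
  extend (fun _ : unit_cells => 1%Z : trivial_module M).

Lemma aug_bas b : aug (bas b) = 1%Z.
Proof. by rewrite [LHS]extend_bas mr_of_trivial. Qed.

(** All generator indices are below [m], so an irreducible element has no generator as right
    divisor. *)
Lemma unit_cells_irreducible (b : M * unit_cells) :
  ~ reducible b -> b = (1%g, tt).
Proof.
case: b => x [] bI; congr (_, _); apply/eqP/negPn/negP => /X_gen[i xi].
by apply: bI; exists i; rewrite /norm /= ?mulg1.
Qed.

Lemma unit_cells_reducible (b : M * unit_cells) : reducible b -> b.1 != 1%g.
Proof.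
case=> i _ [u ub]; apply: contraNneq (X_neq1 i) => b1.
move: ub; rewrite /norm /= mulg1 b1 => /esym uX1.
by apply/eqP; move: (uX1); rewrite (mulg_eq1 uX1) mul1g.
Qed.

(** Irreducible chains are integer multiples of 1[]; any other basis element has the same
    augmentation as the lower 1[]. *)
Lemma aug_adapted : adapted aug.
Proof.
split=> [v vI|b /unit_cells_reducible b1].
  have -> : aug v = coef (1%g, tt) v.
    apply: (lies_ind (Q := fun v => aug v = coef (1%g, tt) v) _ _ _ vI).
    - by rewrite coef0; exact: linear0.
    - by move=> u w Eu Ew; rewrite coefB -Eu -Ew; exact: linearB.
    by move=> b /unit_cells_irreducible->; rewrite aug_bas coef_bas eqxx.
  move=> v0; apply: coef_eqP => b; rewrite coef0.
  have [//|/[dup] bv /vI /unit_cells_irreducible bE] := eqVneq (coef b v) 0.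
  by rewrite bE v0.
exists (bas (1%g, tt)); split; last by rewrite !aug_bas.
apply: lies_bas; left; exists b.1 => //.
by rewrite /norm /= !mulg1 mul1g.
Qed.

Fixpoint stage n : cells := if n is n'.+1 then next (stage n') else unit_cells.

(** Each prepended generator lowers the first index, so no cell exists beyond degree [m]. *)
Lemma stage_first n (c : stage n) : (first c + n <= m)%N.
Proof.
elim: n c => [|n IHn] c /=; first by rewrite addn0.
case: c => p pP; have [lp _ _] := asboolP _ pP.
by rewrite addnS -addSn; apply: leq_trans (IHn p.2); rewrite leq_add2r.
Qed.

Definition order_chain n : lmodType ZM := chain (stage n).

Fixpoint order_boundary n : {linear order_chain n.+1 -> order_chain n} :=
  if n is n'.+1 then boundary (order_boundary n') else boundary aug.

Lemma order_boundary_adapted n : adapted (order_boundary n).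
Proof.
elim: n => [|n IHn]; first exact: boundary_adapted aug_adapted.
exact: boundary_adapted IHn.
Qed.

Lemma order_resolution : finite_free_resolution m order_boundary aug.
Proof.
split=> [i _|i mi v|a||[|i]].
- exact: free_ffun.
- apply/ffunP => c; have := leq_trans (leq_addl _ _) (stage_first c).
  by rewrite leqNgt mi.
- exists (bas (1%g, tt) *~ a).
  by rewrite raddfMz /= aug_bas; exact: intz.
- exact: boundary_exact_at aug_adapted.
- exact: boundary_exact_at (order_boundary_adapted 0).
- exact: boundary_exact_at (order_boundary_adapted i.+1).
Qed.

End OrderResolution.

(** * Generators and conclusion *)

(** The last letter other than 1 in a word for [x] right-divides [x]. *)
Lemma nontrivial_generators (M : monoidType) : finitely_generated M ->
  exists m (X : 'I_m -> M), (forall i, X i != 1%g) /\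
    forall x, x != 1%g -> exists i, left_multiple x (X i).
Proof.
case=> s sP; pose t := [seq y <- s | y != 1%g].
exists (size t), (tnth (in_tuple t)); split=> [i|x].
  by have := mem_tnth i (in_tuple t); rewrite mem_filter => /andP[].
have [w ws ->] := sP x; elim/last_ind: w ws => [|w y IHw] ws.
  by rewrite big_nil eqxx.
have [wy_s ys] : {subset w <= s} /\ y \in s.
  by split=> [z zw|]; apply: ws; rewrite mem_rcons inE ?eqxx // zw orbT.
rewrite -cats1 big_cat big_seq1 /=; have [->|y1 _] := eqVneq y 1%g.
  by rewrite mulg1; apply: IHw.
have /tnthP[i yi] : y \in in_tuple t by rewrite mem_filter y1.
by exists i, (\prod_(z <- w) z)%g; rewrite -yi.
Qed.

Theorem theorem0p1 (M : monoidType)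
  (hfg : finitely_generated M) (hM : locally_left_gaussian M) :
  type_FL M.
Proof.
case: hM => mulIg noeth lcm_ex.
have [m [X [X1 X_gen]]] := nontrivial_generators hfg.
(* Choice yields total functions, arbitrary where no common left multiple exists. *)
have lcm_opt (p : M * M) : exists w,
    (exists z, common_left_multiple p.1 p.2 z) -> left_lcm p.1 p.2 w.
  have [/lcm_ex[w wP]|nz] := pselect (exists z, common_left_multiple p.1 p.2 z).
    by exists w.
  by exists 1%g => /nz.
have [lcm lcmP] := choice lcm_opt.
have cof_opt (p : M * M) : exists u,
    (exists z, common_left_multiple p.1 p.2 z) -> lcm p = (u * p.2)%g.
  have [/lcmP[[_ [u up]] _]|nz] :=
      pselect (exists z, common_left_multiple p.1 p.2 z).
    by exists u.
  by exists 1%g => /nz.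
have [cof cofP] := choice cof_opt.
have := order_resolution (X := X) (lcm := fun x y => lcm (x, y))
  (cof := fun x y => cof (x, y)) mulIg (no_infinite_descent_wf noeth)
  (fun x y => lcmP (x, y)) (fun x y => cofP (x, y)) X1 X_gen.
by exists m; do 3 eexists; eassumption.
Qed.
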